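(* Let $\mathfrak{g}$ be a nice nilpotent Lie algebra with nice basis $\mathcal{B}=\{e_1,\dots,e_n\}$ and nice diagram $\Delta$, and let $\sigma$ be an arrow-breaking involution of the set of nodes of $\Delta$. Then every $\sigma$-diagonal metric on $\mathfrak{g}$ (with respect to $\mathcal{B}$) is Ricci-flat.
   Context: Lie algebras are real and finite-dimensional. A basis $\mathcal{B}=\{e_1,\dots,e_n\}$ of a Lie algebra $\mathfrak{g}$, with dual basis $\{e^1,\dots,e^n\}$, is nice if each $[e_i,e_j]$ is a multiple of a single basis element $e_k$ depending on $i,j$, and each interior product $e_i\lrcorner de^j$ (where $d$ is the Chevalley--Eilenberg differential, $de^j(x,y)=-e^j([x,y])$) is a multiple of a single $e^h$ depending on $i,j$. A nice nilpotent Lie algebra is a nilpotent Lie algebra $\mathfrak{g}$ together with a nice basis $\mathcal{B}$. Its nice diagram $\Delta$ is the directed graph with set of nodes $\mathcal{B}$ and labeled arrows, where $x\xrightarrow{y}z$ is an arrow with source $x$, destination $z$ and label $y$ ($x,y,z\in\mathcal{B}$) if and only if $[x,y]$ is a nonzero multiple of $z$. An arrow-breaking involution is a permutation $\sigma$ of the set of nodes of order two such that: (1) whenever $x$ has an incoming arrow with label $y$, then $\sigma(x)$ does not have an incoming arrow with label $\sigma(y)$; (2) whenever $x$ has an outgoing arrow with label $y$, then $\sigma(x)$ does not have an outgoing arrow with label $\sigma(y)$. A metric on $\mathfrak{g}$ is a nondegenerate symmetric bilinear form (of any signature), identified with the left-invariant pseudo-Riemannian metric it defines on a Lie group with Lie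 algebra $\mathfrak{g}$; Ricci-flat means that the Ricci tensor of the Levi-Civita connection of this left-invariant metric vanishes. For an order two permutation $\sigma$ of $\mathcal{B}$ write $e_{\sigma_i}=\sigma(e_i)$. A $\sigma$-diagonal metric is a metric with $\langle e_i,e_{\sigma_j}\rangle=g_i\delta_{ij}$, where the $g_i$ are nonzero reals with $g_{\sigma_i}=g_i$. *)

(* Defs.v *)
From HB Require Import structures.
From mathcomp Require Import all_boot all_order all_algebra all_fingroup.
From mathcomp Require Import sesquilinear reals.

Set Implicit Arguments.
Unset Strict Implicit.
Unset Printing Implicit Defensive.

Import Order.TTheory GRing.Theory Num.Theory.
Local Open Scope ring_scope.

Section LieAlgebra.
Context {R : realType} {V : vectType R}.
Variable br : {bilinear V -> V -> V}.

Definition is_lie_bracket : Prop :=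
  (forall x : V, br x x = 0) /\
  (forall x y z : V, br x (br y z) + br y (br z x) + br z (br x y) = 0).

(* Lower central series g, [g, g], [g, [g, g]], and so on; by bilinearity
   [g, h] is spanned by the brackets of basis vectors of g and h. *)
Fixpoint lower_central (k : nat) : {vspace V} :=
  if k is k'.+1 then
    <<[seq br x y | x <- vbasis {:V}, y <- vbasis (lower_central k')]>>%VS
  else {:V}%VS.

Definition lie_nilpotent : Prop := exists k, lower_central k = 0%VS.

Section NiceBasis.
Variables (n : nat) (e : n.-tuple V).

(* The differential d e^j of the dual basis element e^j = coord e j. *)
Definition d_dual (j : 'I_n) (x y : V) : R := - coord e j (br x y).

Definition nice_basis : Prop :=
  [/\ basis_of {:V} e,
      forall i j : 'I_n, exists (k : 'I_n) (c : R), br e`_i e`_j = c *: e`_k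
    & forall i j : 'I_n, exists (h : 'I_n) (c : R),
        forall x : V, d_dual j e`_i x = c * coord e h x].

(* The nice diagram: a node e_i is represented by its index i, and
   [arrow x y z] is the arrow x --y--> z with label y. *)
Definition arrow (x y z : 'I_n) : Prop :=
  exists2 c : R, c != 0 & br e`_x e`_y = c *: e`_z.

Definition has_incoming (x y : 'I_n) : Prop := exists w, arrow w y x.
Definition has_outgoing (x y : 'I_n) : Prop := exists z, arrow x y z.

Definition arrow_breaking_involution (s : {perm 'I_n}) : Prop :=
  [/\ #[s]%g = 2%N,
      forall x y, has_incoming x y -> ~ has_incoming (s x) (s y)
    & forall x y, has_outgoing x y -> ~ has_outgoing (s x) (s y)].

End NiceBasis.

Section Metric.
Variable g : {symmetric V}.

(* The Levi-Civita connection of the left-invariant metric g, restricted to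
   left-invariant vector fields: the functions g y z are constant, so metric
   compatibility reads 0 = g (nabla_x y) z + g y (nabla_x z). *)
Definition is_levi_civita (nabla : {bilinear V -> V -> V}) : Prop :=
  (forall x y : V, nabla x y - nabla y x = br x y) /\
  (forall x y z : V, g (nabla x y) z + g y (nabla x z) = 0).

Definition curvature (nabla : {bilinear V -> V -> V}) (x y z : V) : V :=
  nabla x (nabla y z) - nabla y (nabla x z) - nabla (br x y) z.

Definition endo_trace (f : V -> V) : R :=
  \sum_i coord (vbasis {:V}) i (f (vbasis {:V})`_i).

(* Ric(y, z) = tr (x |-> R(x, y) z). *)
Definition ricci (nabla : {bilinear V -> V -> V}) (y z : V) : R :=
  endo_trace (fun x => curvature nabla x y z).

(* For nondegenerate g the connection is unique: see levi_civita_unique. *)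
Definition ricci_flat : Prop :=
  exists2 nabla : {bilinear V -> V -> V},
    is_levi_civita nabla & forall y z : V, ricci nabla y z = 0.

Lemma levi_civita_unique (nabla1 nabla2 : {bilinear V -> V -> V}) :
  nondegenerate g -> is_levi_civita nabla1 -> is_levi_civita nabla2 ->
  forall x y : V, nabla1 x y = nabla2 x y.
Proof.
move=> g_nd [t1 m1] [t2 m2].
pose D x y := nabla1 x y - nabla2 x y.
have gC u v : g u v = g v u by rewrite hermC expr0 mul1r.
have Dsym x y : D x y = D y x.
  have E (nb : {bilinear V -> V -> V}) :
      nb x y - nb y x = br x y -> nb x y = br x y + nb y x.
    by move=> <-; rewrite subrK.
  by rewrite /D (E _ (t1 x y)) (E _ (t2 x y)) opprD addrACA subrr add0r.
have Dskew x y z : g (D x y) z = - g (D x z) y.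
  have E (nb : {bilinear V -> V -> V}) :
      g (nb x y) z + g y (nb x z) = 0 -> g (nb x y) z = - g (nb x z) y.
    by move=> /eqP; rewrite addr_eq0 => /eqP ->; rewrite gC.
  by rewrite /D !linearBl /= (E _ (m1 x y z)) (E _ (m2 x y z)) opprB opprK addrC.
have D0 x y z : g (D x y) z = 0.
  have: g (D x y) z = - g (D x y) z.
    by rewrite {1}Dskew Dsym Dskew Dsym Dskew opprK Dsym.
  by move/eqP; rewrite -addr_eq0 -mulr2n mulrn_eq0 /= => /eqP.
move=> x y; apply/eqP; rewrite -subr_eq0 -memv0.
by move: g_nd => /eqP <-; apply/mem_orthovP => v _; exact: D0.
Qed.

End Metric.

(* <e_i, e_(s j)> = d_i delta_ij with the d_i nonzero and d_(s i) = d_i. *)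
Definition sigma_diagonal n (e : n.-tuple V) (s : {perm 'I_n})
    (g : {symmetric V}) : Prop :=
  nondegenerate g /\
  exists d : 'I_n -> R,
    [/\ forall i, d i != 0,
        forall i, d (s i) = d i
      & forall i j : 'I_n, g e`_i e`_(s j) = if i == j then d i else 0].

End LieAlgebra.

(* Main.v *)
(* For a torsion-free connection, cyclicity of the trace gives
   Ric(y, z) = tr (x |-> nabla_x (nabla_y z)) - tr (x |-> nabla_(nabla_x y) z).
   Expand both traces in the nice basis with the Koszul formula.  In the first
   one each diagonal term vanishes.  The second is a sum over (i, j) of products
   of a part symmetric in (i, j), coming from ad and its adjoint, and an
   antisymmetric part: the mixed products cancel under i <-> j, while the others
   vanish one by one, those of the form ad ad because nilpotency forbids loops
   and 2-cycles of arrows, the rest because two arrows exchanged by sigma would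
   violate (1) or (2). *)
Require Import Defs.
From HB Require Import structures.
From mathcomp Require Import all_boot all_order all_algebra all_fingroup.
From mathcomp Require Import sesquilinear reals.
From mathcomp Require Import ring.

Set Implicit Arguments.
Unset Strict Implicit.
Unset Printing Implicit Defensive.

Import GRing.Theory Num.Theory.
Local Open Scope ring_scope.

(** * Traces in arbitrary bases and the Ricci tensor *)

Section Trace.
Context {R : realType} {V : vectType R}.

(** [endo_trace] is tied to [vbasis]; this moves it to the nice basis. Expanding each basis in the
    other turns both sides into one double sum. *)
Lemma endo_traceE (n : nat) (e : n.-tuple V) (f : {linear V -> V}) :
  basis_of {:V} e -> endo_trace f = \sum_i coord e i (f e`_i).
Proof.
move=> eB; have vB := vbasisP {:V}.
transitivity (\sum_(i < \dim {:V}) \sum_(j < n) coord e j (f (vbasis {:V})`_i) *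
                             coord (vbasis {:V}) i e`_j).
  apply: eq_bigr => i _; rewrite {1}(coord_basis eB (memvf (f _))) linear_sum.
  by apply: eq_bigr => j _; rewrite linearZ.
rewrite exchange_big; apply: eq_bigr => j _ /=.
rewrite [in RHS](coord_basis vB (memvf e`_j)) !linear_sum.
by apply: eq_bigr => i _; rewrite !linearZ /= mulrC.
Qed.

Lemma endo_trace_comp (f h : {linear V -> V}) :
  endo_trace (f \o h) = endo_trace (h \o f).
Proof.
have E (p q : {linear V -> V}) : endo_trace (p \o q) =
    \sum_(i < \dim {:V}) \sum_(j < \dim {:V}) coord (vbasis {:V}) j (q (vbasis {:V})`_i) *
                  coord (vbasis {:V}) i (p (vbasis {:V})`_j).
  apply: eq_bigr => i _ /=.
  rewrite {1}(coord_vbasis (memvf (q _))) !linear_sum.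
  by apply: eq_bigr => j _; rewrite !linearZ.
rewrite !E exchange_big; apply: eq_bigr => i _; apply: eq_bigr => j _.
exact: mulrC.
Qed.

(* For a torsion-free connection, the terms
   [nabla y (nabla x z)] and [nabla (nabla y x) z] of the curvature have the
   same trace in [x], because [tr (f \o h) = tr (h \o f)]. *)
Lemma ricci_torsion_free (br nabla : {bilinear V -> V -> V}) (y z : V) :
  (forall u v, nabla u v - nabla v u = br u v) ->
  ricci br nabla y z = endo_trace (fun x => nabla x (nabla y z))
                     - endo_trace (fun x => nabla (nabla x y) z).
Proof.
move=> tf.
have E : endo_trace (fun x => nabla (nabla y x) z) =
         endo_trace (fun x => nabla y (nabla x z)).
  exact: (endo_trace_comp (applyr nabla z) (nabla y)).
(* With the two traces equated by [E] inserted, the identity holds for each [x] separately. *)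
rewrite -[LHS]addr0 -{1}(subrr (endo_trace (fun x => nabla (nabla y x) z))).
rewrite {1}E /ricci /endo_trace -!sumrN -!big_split /=; apply: eq_bigr => i _.
by rewrite /curvature -tf linearBl !linearB /=; ring.
Qed.

End Trace.

(** * Eigenvectors of products of adjoint maps *)

Section Nilpotent.
Context {R : realType} {V : vectType R}.
Variable br : {bilinear V -> V -> V}.
Implicit Types (x y v : V) (c : R).

Lemma lower_central_br k x v :
  v \in lower_central br k -> br x v \in lower_central br k.+1.
Proof.
move=> vk; rewrite (coord_vbasis (memvf x)) (coord_vbasis vk) linear_sumlz.
apply: memv_suml => i _; rewrite linear_sumr; apply: memv_suml => j _.
rewrite linearZl_LR linearZr_LR /=; do 2!apply: memvZ; apply: memv_span.
by apply: allpairs_f; apply: mem_nth; rewrite size_tuple.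
Qed.

(** Such a [v] lies in every term of the lower central series. The induction carries [br y v] along,
    since each of the two vectors is, up to a scalar, a bracket with the other. *)
Lemma nilpotent_ad_ad x y v c : lie_nilpotent br ->
  br x (br y v) = c *: v -> c != 0 -> v = 0.
Proof.
move=> [k k0] E c0.
suff: v \in lower_central br k by rewrite k0 memv0 => /eqP.
suff: (v \in lower_central br k) && (br y v \in lower_central br k).
  by case/andP.
elim: k {k0} => [|k /andP[vk yk]]; first by rewrite !memvf.
rewrite (lower_central_br _ vk) andbT.
have -> : v = c^-1 *: br x (br y v) by rewrite E scalerA mulVf ?scale1r.
by apply: memvZ; apply: lower_central_br.
Qed.

Lemma nilpotent_ad x v c : lie_nilpotent br ->
  br x v = c *: v -> c != 0 -> v = 0.
Proof.
move=> nil E c0; apply: (@nilpotent_ad_ad x x v (c * c)) => //.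
  by rewrite E linearZr_LR /= E scalerA.
by rewrite mulf_neq0.
Qed.

End Nilpotent.

(** * The Levi-Civita connection from the Koszul formula *)

Section LeviCivita.
Context {R : realType} {V : vectType R}.
Variables (br : {bilinear V -> V -> V}) (g : {symmetric V}).
Implicit Types x y z : V.

Lemma symformC x y : g x y = g y x.
Proof. by rewrite hermC expr0 mul1r. Qed.

Lemma symformZl (a : R) x y : g (a *: x) y = a * g x y.
Proof. exact: linearZl_LR. Qed.

Lemma symformZr (a : R) x y : g x (a *: y) = a * g x y.
Proof. exact: linearZr_LR. Qed.

(** Koszul formula for left-invariant fields, where the derivative terms vanish. *)
Definition koszul x y z : R :=
  2^-1 * (g (br x y) z - g (br y z) x + g (br z x) y).

Lemma koszul_linear1 a x x' y z :
  koszul (a *: x + x') y z = a * koszul x y z + koszul x' y z.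
Proof.
rewrite /koszul !(linearDl, linearDr, linearZl_LR, linearZr_LR) /=.
ring.
Qed.

Lemma koszul_linear2 a x y y' z :
  koszul x (a *: y + y') z = a * koszul x y z + koszul x y' z.
Proof.
rewrite /koszul !(linearDl, linearDr, linearZl_LR, linearZr_LR) /=.
ring.
Qed.

Lemma koszul_linear3 a x y z z' :
  koszul x y (a *: z + z') = a * koszul x y z + koszul x y z'.
Proof.
rewrite /koszul !(linearDl, linearDr, linearZl_LR, linearZr_LR) /=.
ring.
Qed.

Variables (n : nat) (e f : n.-tuple V).

(** Here [f] stands for the [g]-dual basis of [e], a relation expressed below by [expand_f] and
    [expand_e]. *)
Definition levi_civita x y : V := \sum_(i < n) koszul x y e`_i *: f`_i.

Lemma levi_civita_bilinear : bilinear_for *:%R *:%R levi_civita.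
Proof.
split=> u a x y /=; rewrite /levi_civita scaler_sumr -big_split /=;
  apply: eq_bigr => i _.
- by rewrite koszul_linear1 scalerDl scalerA.
- by rewrite koszul_linear2 scalerDl scalerA.
Qed.

HB.instance Definition _ := bilinear_isBilinear.Build R V V V *:%R *:%R
  levi_civita levi_civita_bilinear.


Hypothesis br_lie : is_lie_bracket br.
Hypothesis expand_f : forall v, v = \sum_(i < n) g v e`_i *: f`_i.
Hypothesis expand_e : forall v, v = \sum_(i < n) g v f`_i *: e`_i.

Lemma lie_bracketC x y : br x y = - br y x.
Proof.
apply/eqP; rewrite -addr_eq0; have := br_lie.1 (x + y).
by rewrite linearDl !linearDr !br_lie.1 add0r addr0 => ->.
Qed.

Lemma levi_civitaE x y z : g (levi_civita x y) z = koszul x y z.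
Proof.
have k0 : koszul x y 0 = 0 by rewrite /koszul !(linear0r, linear0l); ring.
have kS : koszul x y z = \sum_(i < n) g z f`_i * koszul x y e`_i.
  rewrite {1}(expand_e z).
  elim/big_rec2: _ => [|i _ w _ <-]; first exact: k0.
  exact: koszul_linear3.
rewrite kS linear_sumlz; apply: eq_bigr => i _.
by rewrite [LHS]symformZl (symformC z) mulrC.
Qed.

Lemma levi_civitaP : is_levi_civita br g levi_civita.
Proof.
split=> [x y|x y z]; last first.
  rewrite levi_civitaE symformC levi_civitaE /koszul.
  rewrite (lie_bracketC y z) (lie_bracketC x z) (lie_bracketC y x).
  by rewrite !linearNl; ring.
rewrite [RHS]expand_f /= /levi_civita -sumrB; apply: eq_bigr => i _.
rewrite -scalerBl; congr (_ *: _); rewrite /koszul.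
rewrite (lie_bracketC y x) (lie_bracketC e`_i x) (lie_bracketC e`_i y).
by rewrite !linearNl /=; field.
Qed.

End LeviCivita.

(** * Sigma-diagonal metrics on a nice basis *)

Section SigmaDiagonal.
Context {R : realType} {V : vectType R}.
Variables (br : {bilinear V -> V -> V}) (g : {symmetric V}).
Variables (n : nat) (e : n.-tuple V) (s : {perm 'I_n}) (d : 'I_n -> R).
Hypothesis br_lie : is_lie_bracket br.
Hypothesis br_nil : lie_nilpotent br.
Hypothesis e_nice : nice_basis br e.
Hypothesis s_breaking : arrow_breaking_involution br e s.
Hypothesis d_neq0 : forall i, d i != 0.
Hypothesis d_invariant : forall i, d (s i) = d i.
Hypothesis g_diag :
  forall i j : 'I_n, g e`_i e`_(s j) = if i == j then d i else 0.

Lemma breakingK : involutive s.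
Proof.
move=> i; case: s_breaking => s2 _ _.
by have := congr1 (fun p : {perm 'I_n} => p i) (expg_order s);
  rewrite s2 expgS expg1 permM perm1.
Qed.

Lemma nice_basis_of : basis_of {:V} e. Proof. by case: e_nice. Qed.

Lemma nice_expand v : v = \sum_(i < n) coord e i v *: e`_i.
Proof. exact: coord_basis nice_basis_of (memvf v). Qed.

Lemma nice_neq0 (i : 'I_n) : e`_i != 0.
Proof.
apply: contra_eq_neq (coord_free i i (basis_free nice_basis_of)) => ->.
by rewrite linear0 eqxx eq_sym oner_eq0.
Qed.

Lemma form_basis (i j : 'I_n) : g e`_i e`_j = if i == s j then d i else 0.
Proof. by rewrite -{1}(breakingK j) g_diag. Qed.

Lemma form_coord v (i : 'I_n) : g v e`_i = d i * coord e (s i) v.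
Proof.
rewrite {1}(nice_expand v) linear_sumlz (bigD1 (s i)) //= big1 ?addr0.
  by rewrite [LHS]symformZl form_basis eqxx d_invariant mulrC.
move=> j ji; rewrite [LHS]symformZl form_basis.
by rewrite (negPf ji) mulr0.
Qed.

(** The [g]-dual basis of [e]: only [e_(s i)] pairs nontrivially with [e_i], with value [d i]. *)
Definition dual_basis : n.-tuple V := [tuple (d i)^-1 *: e`_(s i) | i < n].

Lemma dual_basisE (i : 'I_n) : dual_basis`_i = (d i)^-1 *: e`_(s i).
Proof. by rewrite -tnth_nth tnth_mktuple. Qed.

Lemma coord_form v (i : 'I_n) : coord e i v = (d i)^-1 * g v e`_(s i).
Proof. by rewrite form_coord breakingK d_invariant mulKf. Qed.

Lemma dual_expand_e v : v = \sum_(i < n) g v dual_basis`_i *: e`_i.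
Proof.
rewrite {1}(nice_expand v); apply: eq_bigr => i _.
by rewrite coord_form dual_basisE symformZr.
Qed.

Lemma dual_expand_f v : v = \sum_(i < n) g v e`_i *: dual_basis`_i.
Proof.
rewrite {1}(nice_expand v) (reindex_inj (@perm_inj _ s)).
apply: eq_bigr => i _ /=.
by rewrite coord_form dual_basisE breakingK d_invariant scalerA mulrC.
Qed.

(** * Structure constants with lowered index, read as arrows *)

Local Notation nabla := (levi_civita br g e dual_basis).
Local Notation c i j k := (g (br e`_i e`_j) e`_k).

Lemma arrow_form (i j k : 'I_n) : c i j k != 0 -> arrow br e i j (s k).
Proof.
move=> c0; have [_ /(_ i j)[m [a E]] _] := e_nice.
have := c0; rewrite E symformZl form_basis mulf_eq0 negb_or.
have [<- /andP[a0 _]|_] := eqVneq m (s k); first by exists a.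
by rewrite eqxx andbF.
Qed.

Lemma arrowC (i j k : 'I_n) : arrow br e i j k -> arrow br e j i k.
Proof.
move=> [a a0 E]; exists (- a); rewrite ?oppr_eq0 //.
by rewrite (lie_bracketC br_lie) E scaleNr.
Qed.

Lemma no_arrow_loop (a i : 'I_n) : ~ arrow br e a i i.
Proof.
move=> [b b0 E]; have /eqP := nilpotent_ad br_nil E b0.
exact/negP/nice_neq0.
Qed.

Lemma no_arrow_2cycle (a b i j : 'I_n) :
  arrow br e a i j -> ~ arrow br e b j i.
Proof.
move=> [u u0 Eu] [v v0 Ev].
have E2 : br e`_b (br e`_a e`_i) = (u * v) *: e`_i.
  by rewrite Eu linearZr_LR /= Ev scalerA.
have /eqP := nilpotent_ad_ad br_nil E2 (mulf_neq0 u0 v0).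
exact/negP/nice_neq0.
Qed.

Lemma no_incoming_pair (a b i j k : 'I_n) :
  arrow br e a i k -> ~ arrow br e b (s i) (s k).
Proof.
case: s_breaking => _ Hin _ A B.
by apply: (Hin k i); [exists a | exists b].
Qed.

Lemma no_outgoing_pair (i j k l : 'I_n) :
  arrow br e i j k -> ~ arrow br e (s i) (s j) l.
Proof.
case: s_breaking => _ _ Hout A B.
by apply: (Hout i j); [exists k | exists l].
Qed.

Lemma form_bracketC x y z : g (br x y) z = - g (br y x) z.
Proof. by rewrite (lie_bracketC br_lie) linearNl. Qed.

(** Splits the coefficient under [i <-> j]: the first two terms, from [ad e_a] and its adjoint, form
    the symmetric part, the last one the antisymmetric part. *)
Lemma koszul_eq (i j a : 'I_n) :
  koszul br g e`_i e`_a e`_j = - 2^-1 * (c a i j + c a j i + c i j a).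
Proof.
by rewrite /koszul (form_bracketC e`_i e`_a) (form_bracketC e`_j e`_i); ring.
Qed.

(** The first two terms would give loops at [i] and at [s i]. For the third, antisymmetry of the
    bracket turns an arrow from [i] labelled [s i] into one from [s i] labelled [i], against
    condition (2). *)
Lemma trace_nabla_basis (a i : 'I_n) : koszul br g e`_i e`_a e`_(s i) = 0.
Proof.
rewrite koszul_eq.
have -> : c a i (s i) = 0.
  apply/eqP/negP => /negP /arrow_form; rewrite breakingK; exact: no_arrow_loop.
have -> : c a (s i) i = 0.
  by apply/eqP/negP => /negP /arrow_form; exact: no_arrow_loop.
have -> : c i (s i) a = 0.
  apply/eqP/negP => /negP /arrow_form A; apply: (@no_outgoing_pair _ _ _ (s a) A).
  by rewrite breakingK; exact: arrowC.
by rewrite !addr0 mulr0.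
Qed.

Lemma mulf_eq0_contra (x y : R) : (x != 0 -> y != 0 -> False) -> x * y = 0.
Proof.
move=> H; apply/eqP; rewrite mulf_eq0 -[_ || _]negbK negb_or.
by apply/negP => /andP[x0 y0]; exact: H.
Qed.

Lemma koszul_pair_antisym (a b i j : 'I_n) :
  koszul br g e`_i e`_a e`_j * koszul br g e`_(s j) e`_b e`_(s i) =
  - (koszul br g e`_j e`_a e`_i * koszul br g e`_(s i) e`_b e`_(s j)).
Proof.
(* These are the terms of the Killing form: two nonzero factors would give a 2-cycle between [p] and
   [s q]. *)
have killing (p q : 'I_n) : c a p q * c b (s q) (s p) = 0.
  apply: mulf_eq0_contra => /arrow_form A /arrow_form.
  by rewrite breakingK; exact: no_arrow_2cycle A.
have incoming (p q : 'I_n) : c a p q * c b (s p) (s q) = 0.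
  apply: mulf_eq0_contra => /arrow_form A /arrow_form.
  exact: no_incoming_pair A.
have outgoing : c i j a * c (s i) (s j) b = 0.
  apply: mulf_eq0_contra => /arrow_form A /arrow_form.
  exact: no_outgoing_pair A.
rewrite !koszul_eq (form_bracketC e`_j e`_i) (form_bracketC e`_(s j) e`_(s i)).
have := killing i j; have := killing j i.
have := incoming i j; have := incoming j i; move: outgoing.
move: (c a i j) (c a j i) (c i j a) (c b (s i) (s j)) (c b (s j) (s i))
  (c (s i) (s j) b) => p p' w q q' v wv p'q' pq p'q pq'.
apply/eqP; rewrite -subr_eq0 opprK.
(* Products of [p + p'] with [v] and of [w] with [q + q'] occur with opposite signs and cancel; the
   other products occur twice. *)
have -> : - 2^-1 * (p + p' + w) * (- 2^-1 * (q' + q - v)) +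
  - 2^-1 * (p' + p - w) * (- 2^-1 * (q + q' + v)) =
  2^-1 * (p * q + p' * q + p * q' + p' * q' - w * v) by field.
by rewrite wv p'q' pq p'q pq' !addr0 subr0 mulr0.
Qed.

(** * Vanishing of the two traces *)

Lemma sum_antisym0 (F : 'I_n -> 'I_n -> R) :
  (forall i j, F i j = - F j i) -> \sum_i \sum_j F i j = 0.
Proof.
move=> F_anti; apply/eqP.
have : \sum_i \sum_j F i j = - \sum_i \sum_j F i j.
  rewrite {2}exchange_big -sumrN; apply: eq_bigr => i _.
  by rewrite -sumrN; apply: eq_bigr => j _; exact: F_anti.
by move/eqP; rewrite -addr_eq0 -mulr2n mulrn_eq0.
Qed.

Lemma trace_nabla w : endo_trace (fun x => nabla x w) = 0.
Proof.
rewrite [LHS](endo_traceE (applyr nabla w) nice_basis_of) big1 // => i _ /=.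
rewrite {1}(nice_expand w) linear_sumr linear_sum big1 // => a _.
rewrite linearZr_LR /= linearZ /= (coord_form _ i).
rewrite (levi_civitaE _ dual_expand_e).
by rewrite trace_nabla_basis !mulr0.
Qed.

Lemma trace_nabla_nabla y z :
  endo_trace (fun x => nabla (nabla x y) z) = 0.
Proof.
rewrite [LHS](endo_traceE (applyr nabla z \o applyr nabla y) nice_basis_of) /=.
have basis (a b : 'I_n) :
    \sum_(i < n) coord e i (nabla (nabla e`_i e`_a) e`_b) = 0.
  (* The factor [(d j)^-1] comes from [dual_basis] in the inner connection, [(d i)^-1] from reading
     the coordinate through [g]. Their product is symmetric, so the summand stays antisymmetric. *)
  transitivity (\sum_(i < n) \sum_(j < n) (d i)^-1 * (d j)^-1 *
    (koszul br g e`_i e`_a e`_j * koszul br g e`_(s j) e`_b e`_(s i))).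
    apply: eq_bigr => i _; rewrite {2}/levi_civita linear_sumlz linear_sum /=.
    apply: eq_bigr => j _; rewrite dual_basisE !linearZl_LR /= !linearZ /=.
    rewrite coord_form (levi_civitaE _ dual_expand_e).
    ring.
  apply: sum_antisym0 => i j.
  by rewrite koszul_pair_antisym mulrN [(d i)^-1 * _]mulrC.
have left_basis (a : 'I_n) :
    \sum_(i < n) coord e i (nabla (nabla e`_i e`_a) z) = 0.
  transitivity (\sum_(i < n) \sum_(b < n)
      coord e b z * coord e i (nabla (nabla e`_i e`_a) e`_b)).
    apply: eq_bigr => i _; rewrite {1}(nice_expand z) linear_sumr linear_sum.
    by apply: eq_bigr => b _; rewrite linearZr_LR /= linearZ.
  by rewrite exchange_big big1 // => b _; rewrite -mulr_sumr basis mulr0.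
transitivity (\sum_(i < n) \sum_(a < n)
    coord e a y * coord e i (nabla (nabla e`_i e`_a) z)).
  apply: eq_bigr => i _; rewrite {1}(nice_expand y) linear_sumr linear_sumlz.
  rewrite linear_sum; apply: eq_bigr => a _.
  by rewrite linearZr_LR /= linearZl_LR /= linearZ.
by rewrite exchange_big big1 // => a _; rewrite -mulr_sumr left_basis mulr0.
Qed.

End SigmaDiagonal.

Theorem proposition2p3 (R : realType) (V : vectType R)
    (br : {bilinear V -> V -> V}) (n : nat) (e : n.-tuple V)
    (s : {perm 'I_n}) (g : {symmetric V}) :
  is_lie_bracket br ->
  lie_nilpotent br ->
  nice_basis br e ->
  arrow_breaking_involution br e s ->
  sigma_diagonal e s g ->
  ricci_flat br g.
Proof.
move=> lie nil nice breaking [_ [d [d0 ds gd]]].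
(* Duality of [dual_basis] and [e] makes the Koszul construction a witness for the connection in
   [ricci_flat]. *)
have expand_e := dual_expand_e nice breaking d0 ds gd.
have expand_f := dual_expand_f nice breaking d0 ds gd.
pose nabla : {bilinear V -> V -> V} :=
  levi_civita br g e (dual_basis e s d).
have lc : is_levi_civita br g nabla by exact: levi_civitaP.
exists nabla => // y z; rewrite ricci_torsion_free; last by case: lc.
rewrite (trace_nabla lie nil nice breaking d0 ds gd).
by rewrite (trace_nabla_nabla lie nil nice breaking d0 ds gd) subr0.
Qed.
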